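(* Let $K$ be a commutative discrete hypergroup and let $H$ be a finite subgroup of the center $Z(K)$. If $K$ is a Ramsey hypergroup, then the hypergroup $K//H$ is a Ramsey hypergroup.
   Context: A discrete hypergroup is a set $K$ (discrete topology) with a map assigning to $m,n\in K$ a finitely supported probability measure $\delta_m*\delta_n$ on $K$ (extended bilinearly to measures), associative, with identity $e$, and an involution $m\mapsto\check m$ with $(\delta_m*\delta_n)^\vee=\delta_{\check n}*\delta_{\check m}$ and $e\in\operatorname{spt}(\delta_m*\delta_{\check n})$ iff $m=n$; it is commutative if $\delta_m*\delta_n=\delta_n*\delta_m$. The center $Z(K)$ is the set of $x\in K$ with $\operatorname{spt}(\delta_x*\delta_y)$ a singleton for all $y\in K$; it is a group. For $x\in K$, $z\in Z(K)$, $xz$ denotes the unique element of $\operatorname{spt}(\delta_x*\delta_z)$. For a subgroup $H\subset Z(K)$, $K//H=\{xH:x\in K\}$, $xH=\{xz:z\in H\}$, $\pi(x)=[x]=xH$, and $\delta_{[x]}*\delta_{[y]}$ is the image measure of $\delta_x*\delta_y$ under $\pi$ (i.e. $\int f\,d(\delta_{[x]}*\delta_{[y]})=\int f\circ\pi\, d(\delta_x*\delta_y)$); this makes $K//H$ a hypergroup with identity $[e]$. For an infinite discrete hypergroup $L$ with identity $e$, an injective sequence $\langle x_n\rangle$ in $L\setminus\{e\}$ with range $B$, and nonempty finite $F=\{x_{n_1},\dots,x_{n_m}\}\subset B$ with $n_1<\dots<n_m$, put $\delta_F=\delta_{x_{n_1}}*\cdots*\delta_{x_{n_m}}$. $L$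 is a Ramsey hypergroup if for every finite partition $L=\bigcup_{i=1}^r C_i$ there exist $i$ and an injective sequence $\langle x_n\rangle$ in $L\setminus\{e\}$ with range $B$ such that $\operatorname{spt}(\delta_F)\subset C_i$ for every nonempty finite $F\subset B$. *)

(* Defs.v *)
From HB Require Import structures.
From mathcomp Require Import all_boot all_order all_algebra.
From mathcomp Require Import finmap monalg.
From mathcomp Require Import boolp classical_sets functions cardinality reals.

Set Implicit Arguments.
Unset Strict Implicit.
Unset Printing Implicit Defensive.

Import Order.TTheory GRing.Theory Num.Theory.
Local Open Scope fset_scope.
Local Open Scope classical_set_scope.
Local Open Scope ring_scope.

(** Finitely supported real measures on a discrete space [K] are elements of
    [{malg R[K]}]: [<< x >>] is the point mass at [x], [mu@_x] the mass of
    [mu] at [x], and [msupp mu] the support of [mu].  Only the [R]-module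
    structure of [{malg R[K]}] is used. *)

Section Measures.
Context {R : realType}.

Definition is_prob (K : choiceType) (mu : {malg R[K]}) : Prop :=
  (forall x, 0 <= mu@_x) /\ \sum_(x <- msupp mu) mu@_x = 1.

(** The integral of the vector-valued function [f] against [mu]. *)
Definition mint (K : choiceType) (V : lmodType R) (f : K -> V)
  (mu : {malg R[K]}) : V := \sum_(x <- msupp mu) mu@_x *: f x.

Definition mimage (K L : choiceType) (f : K -> L) (mu : {malg R[K]}) :
  {malg R[L]} := mint (fun x => << f x >>) mu.

(** The bilinear extension to measures of a convolution given on points. *)
Definition mconv (K : choiceType) (c : K -> K -> {malg R[K]})
  (mu nu : {malg R[K]}) : {malg R[K]} :=
  \sum_(x <- msupp mu) \sum_(y <- msupp nu) (mu@_x * nu@_y) *: c x y.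

Lemma msupp_dirac (K : choiceType) (x : K) :
  msupp (<< x >> : {malg R[K]}) = [fset x]%fset.
Proof. by rewrite msuppU oner_eq0. Qed.

Lemma mcoeff_dirac (K : choiceType) (x y : K) :
  (<< x >> : {malg R[K]})@_y = (x == y)%:R.
Proof. by rewrite mcoeffU. Qed.

Lemma mintEw (K : choiceType) (V : lmodType R) (f : K -> V) mu (d : {fset K}) :
  (msupp mu `<=` d)%fset -> mint f mu = \sum_(x <- d) mu@_x *: f x.
Proof.
move=> sd; rewrite /mint (big_fset_incl _ sd) // => x _ xmu.
by rewrite mcoeff_outdom // scale0r.
Qed.

Lemma mint_is_linear (K : choiceType) (V : lmodType R) (f : K -> V) :
  linear (mint f).
Proof.
move=> a mu nu.
have s1 : (msupp (a *: mu + nu) `<=` msupp mu `|` msupp nu)%fset.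
  apply: (fsubset_trans (msuppD_le _ _)); apply: fsetUSS => //.
  exact: msuppZ_le.
rewrite (mintEw _ s1) (mintEw _ (fsubsetUl _ (msupp nu)))
  (mintEw _ (fsubsetUr (msupp mu) _)) scaler_sumr -big_split /=.
by apply: eq_bigr => x _; rewrite mcoeffD mcoeffZ scalerDl scalerA.
Qed.

HB.instance Definition _ (K : choiceType) (V : lmodType R) (f : K -> V) :=
  GRing.isLinear.Build R {malg R[K]} V *:%R (mint f) (mint_is_linear f).

Lemma mint_dirac (K : choiceType) (V : lmodType R) (f : K -> V) x :
  mint f << x >> = f x.
Proof. by rewrite /mint msupp_dirac big_seq_fset1 mcoeffUU scale1r. Qed.

Lemma mint_comp (K L : choiceType) (V : lmodType R) (g : L -> V)
    (f : K -> {malg R[L]}) mu :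
  mint g (mint f mu) = mint (fun x => mint g (f x)) mu.
Proof.
rewrite [in LHS]/mint -/(mint g _) linear_sum.
by apply: eq_bigr => x _; rewrite linearZ.
Qed.

Lemma eq_mint (K : choiceType) (V : lmodType R) (f g : K -> V) mu :
  (forall x, f x = g x) -> mint f mu = mint g mu.
Proof. by move=> fg; apply: eq_bigr => x _; rewrite fg. Qed.

Lemma mconvE (K : choiceType) (c : K -> K -> {malg R[K]}) mu nu :
  mconv c mu nu = mint (fun x => mint (c x) nu) mu.
Proof.
apply: eq_bigr => x _; rewrite scaler_sumr.
by apply: eq_bigr => y _; rewrite scalerA.
Qed.

Lemma mimage_dirac (K L : choiceType) (f : K -> L) x :
  mimage f << x >> = << f x >>.
Proof. exact: mint_dirac. Qed.

Lemma mint_mimage (K L : choiceType) (V : lmodType R) (f : K -> L)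
    (g : L -> V) mu : mint g (mimage f mu) = mint (fun x => g (f x)) mu.
Proof. by rewrite mint_comp; apply: eq_mint => x; rewrite mint_dirac. Qed.

Lemma mimage_comp (K L M : choiceType) (f : K -> L) (g : L -> M) mu :
  mimage g (mimage f mu) = mimage (fun x => g (f x)) mu.
Proof. exact: mint_mimage. Qed.

Lemma mcoeff_mimage (K L : choiceType) (f : K -> L) mu y :
  (mimage f mu)@_y = \sum_(x <- msupp mu | f x == y) mu@_x.
Proof.
rewrite /mimage /mint raddf_sum [RHS]big_mkcond /=.
apply: eq_bigr => x _; rewrite mcoeffZ mcoeff_dirac.
by case: eqP => _; rewrite ?mulr1 ?mulr0.
Qed.

Lemma msupp_mimage (K L : choiceType) (f : K -> L) mu y :
  (forall x, 0 <= mu@_x) ->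
  (y \in msupp (mimage f mu)) <-> (exists2 x, x \in msupp mu & f x = y).
Proof.
move=> mu0; rewrite -mcoeff_neq0 mcoeff_mimage; split.
  move=> h; apply: contrapT => nex; move/negP: h; apply.
  rewrite big_seq_cond big1 // => x /andP[xmu /eqP fx].
  by case: nex; exists x.
move=> [x xmu fx]; rewrite psumr_neq0; last by move=> *; exact: mu0.
apply/hasP; exists x => //; rewrite fx eqxx /= lt_neqAle mu0 andbT eq_sym.
by rewrite mcoeff_neq0.
Qed.

Lemma mimage_prob (K L : choiceType) (f : K -> L) mu :
  is_prob mu -> is_prob (mimage f mu).
Proof.
move=> [mu0 mu1]; split=> [y|].
  by rewrite mcoeff_mimage; apply: sumr_ge0.
have massE (T : choiceType) (nu : {malg R[T]}) :
    \sum_(x <- msupp nu) nu@_x = mint (fun=> 1 : R^o) nu.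
  by apply: eq_bigr => x _; rewrite /GRing.scale /= mulr1.
by rewrite massE mint_mimage -massE.
Qed.

Lemma prob_singleton (K : choiceType) (mu : {malg R[K]}) w :
  is_prob mu -> msupp mu = [fset w] -> mu = << w >>.
Proof.
move=> [_ mu1] sw; apply/malgP => k; rewrite mcoeff_dirac.
have [<-|wk] := eqVneq w k; first by rewrite -mu1 sw big_seq_fset1.
by rewrite mcoeff_outdom // sw in_fset1 eq_sym.
Qed.

End Measures.

HB.mixin Record isHypergroup (R : realType) K of Choice K := {
  hunit : K;
  hcheck : K -> K;
  hconv : K -> K -> {malg R[K]};
  hconv_prob : forall m n, is_prob (hconv m n);
  hconvA : forall m n p,
    mconv hconv (hconv m n) << p >> = mconv hconv << m >> (hconv n p);
  hconv1m : forall m, hconv hunit m = << m >>;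
  hconvm1 : forall m, hconv m hunit = << m >>;
  hcheckK : involutive hcheck;
  hcheck_conv : forall m n,
    mimage hcheck (hconv m n) = hconv (hcheck n) (hcheck m);
  hunit_supp : forall m n, hunit \in msupp (hconv m (hcheck n)) <-> m = n
}.

#[short(type="hypergroupType")]
HB.structure Definition Hypergroup (R : realType) :=
  { K of isHypergroup R K & Choice K }.

HB.mixin Record Hypergroup_isCommutative (R : realType) K
    of Hypergroup R K := {
  hconvC_subproof : forall m n : K, hconv m n = hconv n m
}.

#[short(type="comHypergroupType")]
HB.structure Definition ComHypergroup (R : realType) :=
  { K of Hypergroup_isCommutative R K & Hypergroup R K }.

Section Center.
Context {R : realType} {K : hypergroupType R}.

Definition center : set K :=
  [set x | forall y, exists w, msupp (hconv x y) = [fset w]].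

(** The element [xz] of [spt(delta_x * delta_z)], for [z] in the center; the
    default value is irrelevant. *)
Definition cmul (x z : K) : K := xget hunit [set w | w \in msupp (hconv x z)].

End Center.

(** In the group [center] the inverse is given by the involution. *)
Record central_subgroup (R : realType) (K : hypergroupType R) :=
  CentralSubgroup {
    csub :> set K;
    csub_center : csub `<=` center;
    csub1 : csub hunit;
    csubM : forall x y, csub x -> csub y -> csub (cmul x y);
    csubV : forall x, csub x -> csub (hcheck x)
  }.

Lemma hconvC (R : realType) (K : comHypergroupType R) (x y : K) :
  hconv x y = hconv y x.
Proof. exact: hconvC_subproof. Qed.

Section CenterTheory.
Context {R : realType} {K : comHypergroupType R}.
Implicit Types x y z w : K.

Lemma centerP x z : center z -> hconv x z = << cmul x z >>.
Proof.
move=> /(_ x)[w]; rewrite hconvC => sw.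
rewrite (prob_singleton (hconv_prob x z) sw) /cmul sw.
congr << _ >>; case: xgetP => [y _ /=|/(_ w)]; rewrite /= in_fset1.
  by move=> /eqP.
by rewrite eqxx.
Qed.

Lemma dirac_inj : injective (fun x : K => << x >> : {malg R[K]}).
Proof.
move=> x y /(congr1 (@msupp _ _)); rewrite !msupp_dirac.
by move=> /fsetP/(_ x); rewrite !in_fset1 eqxx => /esym/eqP.
Qed.

Lemma cmul1 x : cmul x hunit = x.
Proof.
have e1 : center (hunit : K).
  by move=> y; exists y; rewrite hconv1m msupp_dirac.
by apply: dirac_inj; rewrite /= -(centerP _ e1) hconvm1.
Qed.

Lemma mconv_dirac x y : mconv hconv << x >> << y >> = hconv x y.
Proof. by rewrite mconvE !mint_dirac. Qed.

Lemma cmulA x z u : center z -> center u ->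
  cmul (cmul x z) u = cmul x (cmul z u).
Proof.
move=> cz cu; apply: dirac_inj; rewrite /= -(centerP _ cu).
have := hconvA x z u; rewrite (centerP _ cz) (centerP _ cu) !mconv_dirac => ->.
have [w sw] : exists w, msupp (hconv x (cmul z u)) = [fset w].
  have [v sv] := cz x; have [w sw] := cu v.
  exists w; have := hconvA x z u.
  rewrite (centerP _ cz) (centerP _ cu) !mconv_dirac => <-.
  rewrite hconvC -sw; congr (msupp (hconv u _)); apply: dirac_inj => /=.
  by rewrite -(centerP _ cz) hconvC (prob_singleton (hconv_prob z x) sv).
rewrite (prob_singleton (hconv_prob _ _) sw) /cmul sw.
congr << _ >>; case: xgetP => [y _ /=|/(_ w)]; rewrite /= in_fset1.
  by move=> /eqP.
by rewrite eqxx.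
Qed.

Lemma center_check z : center z -> center (hcheck z).
Proof.
move=> cz y; have [w sw] := cz (hcheck y).
exists (hcheck w); rewrite hconvC -[y]hcheckK -hcheck_conv.
by rewrite (prob_singleton (hconv_prob _ _) sw) mimage_dirac msupp_dirac.
Qed.

Lemma cmul_check z : center z -> cmul z (hcheck z) = hunit.
Proof.
move=> cz; have /hunit_supp : z = z by [].
by rewrite (centerP _ (center_check cz)) msupp_dirac in_fset1 => /eqP.
Qed.

Lemma hcheck_cmul x z : center z ->
  hcheck (cmul x z) = cmul (hcheck x) (hcheck z).
Proof.
move=> cz; apply: dirac_inj; rewrite /= -(centerP _ (center_check cz)) hconvC.
by rewrite -hcheck_conv (centerP _ cz) mimage_dirac.
Qed.

Lemma hconv_cmull x y z : center z ->
  hconv (cmul x z) y = mimage (fun w => cmul w z) (hconv x y).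
Proof.
move=> cz; rewrite -mconv_dirac -(centerP _ cz) hconvC hconvA mconvE mint_dirac.
by apply: eq_mint => w; rewrite hconvC (centerP _ cz).
Qed.

End CenterTheory.

Section Cosets.
Context {R : realType} {K : comHypergroupType R} (H : central_subgroup K).
Implicit Types x y z : K.

Definition coset (x : K) : set K := [set cmul x z | z in H].

(** The space [K//H] of cosets. *)
Definition hquot : Type := {A : set K | `[< exists x, A = coset x >]}.

HB.instance Definition _ := Choice.on hquot.

Definition hproj (x : K) : hquot :=
  exist _ (coset x) (introT (asboolP _) (ex_intro _ x erefl)).

Definition hrepr (a : hquot) : K := sval (cid (elimT (asboolP _) (svalP a))).

Lemma hreprK a : hproj (hrepr a) = a.
Proof.
apply: val_inj; rewrite /=.
by rewrite -(svalP (cid (elimT (asboolP _) (svalP a)))).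
Qed.

Lemma coset_cmul x z : csub H z -> coset (cmul x z) = coset x.
Proof.
move=> Hz; have cz := csub_center Hz.
apply/seteqP; split=> _ [u Hu <-].
  exists (cmul z u); first exact: csubM Hz Hu.
  by rewrite cmulA //; exact: (csub_center Hu).
have Hv := csubV Hz; have cv := csub_center Hv.
have HM : csub H (cmul (hcheck z) u) by exact: csubM Hv Hu.
exists (cmul (hcheck z) u) => //.
have cu := csub_center Hu.
rewrite -cmulA // (cmulA _ cz cv) cmul_check // cmul1 //.
Qed.

Lemma hproj_eqP x y : hproj x = hproj y <-> exists2 z, csub H z & y = cmul x z.
Proof.
split=> [/(congr1 val) /= xy|[z Hz ->]].
  have : coset y y by exists hunit; [exact: csub1|exact: cmul1].
  by rewrite -xy => -[z Hz <-]; exists z.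
by apply: val_inj; rewrite /= coset_cmul.
Qed.

Lemma hproj_cmul x z : csub H z -> hproj (cmul x z) = hproj x.
Proof. by move=> Hz; apply/esym/hproj_eqP; exists z. Qed.

(** Independent of the representatives: see [hquot_convE]. *)
Definition hquot_conv (a b : hquot) : {malg R[hquot]} :=
  mimage hproj (hconv (hrepr a) (hrepr b)).

Definition hquot_check (a : hquot) : hquot := hproj (hcheck (hrepr a)).

Lemma hquot_convE x y :
  hquot_conv (hproj x) (hproj y) = mimage hproj (hconv x y).
Proof.
have conv_l x1 x2 t : hproj x1 = hproj x2 ->
    mimage hproj (hconv x2 t) = mimage hproj (hconv x1 t).
  move=> /hproj_eqP[z Hz ->]; rewrite hconv_cmull; last exact: csub_center Hz.
  by rewrite mimage_comp; apply: eq_mint => w; rewrite hproj_cmul.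
rewrite /hquot_conv (conv_l x); last by rewrite hreprK.
by rewrite hconvC (conv_l y) ?hreprK// hconvC.
Qed.

Lemma hquot_checkE x : hquot_check (hproj x) = hproj (hcheck x).
Proof.
have /hproj_eqP[z Hz e] : hproj x = hproj (hrepr (hproj x)) by rewrite hreprK.
rewrite /hquot_check e hcheck_cmul; last exact: csub_center Hz.
by rewrite hproj_cmul //; exact: csubV Hz.
Qed.

Lemma hquot_prob a b : is_prob (hquot_conv a b).
Proof. by apply: mimage_prob; exact: hconv_prob. Qed.

Lemma mconv_hproj (mu nu : {malg R[K]}) :
  mconv hquot_conv (mimage hproj mu) (mimage hproj nu) =
  mimage hproj (mconv hconv mu nu).
Proof.
rewrite !mconvE mint_mimage /mimage mint_comp; apply: eq_mint => x.
rewrite mint_mimage mint_comp; apply: eq_mint => y.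
exact: hquot_convE.
Qed.

Lemma hquot_convA a b c :
  mconv hquot_conv (hquot_conv a b) << c >> =
  mconv hquot_conv << a >> (hquot_conv b c).
Proof.
rewrite -[a]hreprK -[b]hreprK -[c]hreprK !hquot_convE.
by rewrite -!(@mimage_dirac R _ _ hproj) !mconv_hproj hconvA.
Qed.

Lemma hquot_conv1m a : hquot_conv (hproj hunit) a = << a >>.
Proof. by rewrite -[a]hreprK hquot_convE hconv1m mimage_dirac. Qed.

Lemma hquot_convC a b : hquot_conv a b = hquot_conv b a.
Proof. by rewrite /hquot_conv hconvC. Qed.

Lemma hquot_convm1 a : hquot_conv a (hproj hunit) = << a >>.
Proof. by rewrite hquot_convC hquot_conv1m. Qed.

Lemma hquot_checkK : involutive hquot_check.
Proof. by move=> a; rewrite -[a]hreprK !hquot_checkE hcheckK. Qed.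

Lemma hquot_check_conv a b :
  mimage hquot_check (hquot_conv a b) =
  hquot_conv (hquot_check b) (hquot_check a).
Proof.
rewrite -[a]hreprK -[b]hreprK !hquot_checkE !hquot_convE -hcheck_conv.
by rewrite !mimage_comp; apply: eq_mint => x; rewrite hquot_checkE.
Qed.

Lemma hquot_unit_supp a b :
  hproj hunit \in msupp (hquot_conv a (hquot_check b)) <-> a = b.
Proof.
rewrite -[a]hreprK -[b]hreprK; move: (hrepr a) (hrepr b) => x y; split.
  rewrite hquot_checkE hquot_convE msupp_mimage; last first.
    by move=> w; case: (hconv_prob x (hcheck y)).
  move=> [w wxy /hproj_eqP[v Hv ev]].
  have cv := csub_center Hv.
  have /hunit_supp xy :
      (hunit : K) \in msupp (hconv (cmul x v) (hcheck y)).
    rewrite hconv_cmull // msupp_mimage; first by exists w.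
    by move=> u; case: (hconv_prob x (hcheck y)).
  by rewrite -xy hproj_cmul.
move=> ->; rewrite hquot_checkE hquot_convE msupp_mimage; last first.
  by move=> w; case: (hconv_prob y (hcheck y)).
by exists hunit => //; apply/hunit_supp.
Qed.

HB.instance Definition _ := isHypergroup.Build R hquot hquot_prob hquot_convA
  hquot_conv1m hquot_convm1 hquot_checkK hquot_check_conv hquot_unit_supp.

HB.instance Definition _ := Hypergroup_isCommutative.Build R hquot hquot_convC.

End Cosets.

Section Ramsey.
Context {R : realType}.

(** [delta_(x_(n_1)) * ... * delta_(x_(n_m))] for [ns = [:: n_1; ...; n_m]]. *)
Definition seq_delta (L : hypergroupType R) (x : nat -> L) (ns : seq nat) :
  {malg R[L]} := \big[mconv hconv/<< hunit >>]_(n <- ns) << x n >>.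

Definition Ramsey (L : hypergroupType R) : Prop :=
  infinite_set [set: L] /\
  forall (r : nat) (C : 'I_r -> set L), partition [set: 'I_r] C [set: L] ->
  exists (i : 'I_r) (x : nat -> L),
    [/\ injective x, forall n, x n != hunit &
      forall (F : {fset L}) (ns : seq nat),
        F != fset0 -> sorted ltn ns -> F = [fset x n | n in ns]%fset ->
        [set` msupp (seq_delta x ns)] `<=` C i].

End Ramsey.

(* Main.v *)
Require Import Defs.
From mathcomp Require Import all_boot.
From mathcomp Require Import classical_sets cardinality reals.
From mathcomp Require Import finmap monalg boolp.

Set Implicit Arguments.
Unset Strict Implicit.
Unset Printing Implicit Defensive.

Local Open Scope classical_set_scope.

(** Partitions of [K//H] pull back along the projection.  Its fibers, the cosets
    of [H], are finite, so an injective sequence in [K] has a subsequence whose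
    image in [K//H] is injective and avoids the identity; the projection maps
    the finite products of that subsequence to those of its image. *)

(** Only finitely many indices are sent by [f] to [a] or to one of [f 0], ..., [f n]; [h n] bounds
    them strictly, and iterating [h] yields [g]. *)
Lemma finite_fibers_subseq (T : Type) (f : nat -> T) (a : T) :
  (forall b, finite_set (f @^-1` [set b])) ->
  exists g : nat -> nat,
    [/\ {homo g : m n / m < n}, injective (f \o g) & forall n, f (g n) <> a].
Proof.
move=> ff.
have /choice[h hP] n : exists m, forall k, m <= k ->
    f k <> a /\ forall j, j <= n -> f k <> f j.
  have : finite_set (f @^-1` [set a] `|`
      \bigcup_(j in [set` 'I_n.+1]) f @^-1` [set f j]).
    rewrite finite_setU; split=> //.
    by apply: bigcup_finite => //; exact: finite_finset.
  move=> /finite_seqP[s sE]; exists (\max_(i <- s) i).+1 => k sk.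
  have kNs : ~ [set` s] k.
    by move=> /= /(@leq_bigmax_seq _ s xpredT id)/(_ isT); rewrite leqNgt sk.
  rewrite -sE in kNs; split=> [fka|j jn fkj]; apply: kNs; first by left.
  by right; exists (Ordinal (jn : j < n.+1)).
(* Otherwise [hP] with [k = j = n] gives [f n <> f n]. *)
have h_gt n : n < h n.
  by rewrite ltnNge; apply/negP => /hP[_] /(_ _ (leqnn n)); exact.
(* Starting at [h 0] rather than [0] makes [g 0] avoid [a] too. *)
pose g k := iter k.+1 h 0.
have g_homo : {homo g : m n / m < n}.
  by apply: homo_ltn => [? ? ?|k]; [exact: ltn_trans|exact: h_gt].
have g_neq m n : m < n -> f (g n) <> f (g m).
  (* Here [m.+1 <= n] gives [h (g m) = g m.+1 <= g n]. *)
  by move=> /(ltnW_homo g_homo)/hP[_]; apply.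
exists g; split=> // [m n /= mn|n].
  by case: (ltngtP m n) => // /g_neq; rewrite mn.
by have [] := hP (iter n h 0) (g n) (leqnn _).
Qed.

(** Off the image of the support the mass is an empty sum; cancellation between signed masses can
    only shrink the left side. *)
Lemma msupp_mimage_sub (R : realType) (K L : choiceType) (f : K -> L)
    (mu : {malg R[K]}) :
  [set` msupp (mimage f mu)] `<=` f @` [set` msupp mu].
Proof.
move=> y /=; rewrite -mcoeff_neq0 mcoeff_mimage => /eqP sum_neq0.
apply: contrapT => yNf; apply: sum_neq0.
rewrite big_seq_cond big1 // => x /andP[xmu /eqP fx].
by case: yNf; exists x.
Qed.

Lemma seq_delta_map (R : realType) (L : hypergroupType R) (x : nat -> L)
    (g : nat -> nat) (ns : seq nat) :
  seq_delta (x \o g) ns = seq_delta x (map g ns).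
Proof. by rewrite /seq_delta big_map. Qed.

Section Quotient.
Context (R : realType) (K : comHypergroupType R) (H : central_subgroup K).

(** Pushing forward along the projection commutes with convolution and preserves the identity. *)
Lemma seq_delta_hproj (x : nat -> K) (ns : seq nat) :
  seq_delta (hproj H \o x) ns = mimage (hproj H) (seq_delta x ns).
Proof.
elim: ns => [|n ns IHns]; rewrite /seq_delta ?big_nil ?big_cons.
  by rewrite mimage_dirac.
by rewrite -mconv_hproj mimage_dirac -IHns.
Qed.

Lemma finite_hproj_fiber (a : hquot H) :
  finite_set H -> finite_set (hproj H @^-1` [set a]).
Proof.
move=> H_fin; apply: (@sub_finite_set _ _ (coset H (hrepr a))).
  move=> x /= xa; have /hproj_eqP[z Hz ->] : hproj H (hrepr a) = hproj H x.
    by rewrite hreprK xa.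
  by exists z.
exact: finite_image.
Qed.

Lemma hproj_inj_subseq (x : nat -> K) : finite_set H -> injective x ->
  exists g : nat -> nat, [/\ {homo g : m n / m < n},
    injective (hproj H \o x \o g) & forall n, hproj H (x (g n)) <> hunit].
Proof.
move=> H_fin x_inj; apply: (@finite_fibers_subseq _ (hproj H \o x)) => b.
(* An injective [x] meets each finite coset at finitely many indices. *)
rewrite comp_preimage; apply: finite_preimage; first by move=> ? ? _ _ /x_inj.
exact: finite_hproj_fiber.
Qed.

Lemma infinite_hquot :
  finite_set H -> infinite_set [set: K] -> infinite_set [set: hquot H].
Proof.
move=> H_fin K_inf quot_fin; apply: K_inf.
rewrite -(preimage_setT (hproj H)).
have -> : hproj H @^-1` setT =
    \bigcup_(a in [set: hquot H]) hproj H @^-1` [set a].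
  by apply/seteqP; split=> // x _; exists (hproj H x).
by apply: bigcup_finite => // a _; exact: finite_hproj_fiber.
Qed.

End Quotient.

Theorem theorem3p6 (R : realType) (K : comHypergroupType R)
  (H : central_subgroup K) (H_fin : finite_set H) :
  Ramsey K -> Ramsey (hquot H).
Proof.
move=> [K_inf K_Ramsey]; split; first exact: infinite_hquot.
move=> r C [C_cover C_disj C_neq0].
have [|i [x [x_inj _ x_supp]]] := K_Ramsey r (fun i => hproj H @^-1` C i).
  split.
  - by rewrite -(preimage_setT (hproj H)) -C_cover preimage_bigcup.
  - by move=> i j _ _ [u [Ciu Cju]]; apply: C_disj => //; exists (hproj H u).
  - by move=> i /C_neq0[a Ca]; exists (hrepr a); rewrite /= hreprK.
have [g [g_homo y_inj y_neq]] := hproj_inj_subseq H_fin x_inj.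
exists i, (hproj H \o x \o g); split=> // [n|F ns F_neq0 ns_sorted FE].
  exact/eqP/y_neq.
rewrite seq_delta_map seq_delta_hproj => _ /msupp_mimage_sub[w wx <-].
(* The finite set used in [K] is the image under [x] of [map g ns], which stays sorted because [g]
   is increasing. *)
apply: (x_supp _ _ _ _ erefl w wx); last first.
  exact: homo_sorted g_homo _ ns_sorted.
move: F_neq0; rewrite FE => /fset0Pn[_ /imfsetP[n /= n_ns _]].
by apply/fset0Pn; exists (x (g n)); apply/imfsetP; exists (g n); rewrite ?map_f.
Qed.
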